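(* Let $n\ge 8$ be an even integer and let $I=\{2,3,\ldots,\frac{n}{2}-2\}$. Then the shadow graph of the $2$-section of $3\text{-}UQI(n,2)$ is the merged Johnson graph $J(n,\frac{n}{2})_I$, that is, $$D_2\big([3\text{-}UQI(n,2)]_2\big)=J\big(n,\tfrac{n}{2}\big)_I ,$$ where equality of graphs is understood up to isomorphism.
   Context: $[n]=\{1,\dots,n\}$. Definition of $3\text{-}QI(n,2)$ (for $n\ge 8$): its vertices are all binary strings of length $n$ with entries in $\{0,1\}$ whose first entry is $0$ and in which each symbol occurs at least $4$ times; equivalently, the unordered partitions $\{A,\overline{A}\}$ of $[n]$ with $|A|,|\overline{A}|\ge 4$. Three vertices $v_1,v_2,v_3$ form a hyperedge if and only if for every $(g_1,g_2,g_3)\in\{0,1\}^3$ there is an index $j$ with $v_i[j]=g_i$ for $i=1,2,3$ (equivalently, all eight triple intersections of parts, one part from each partition, are non-empty). For $n$ even, $3\text{-}UQI(n,2)$ is the subhypergraph of $3\text{-}QI(n,2)$ induced on the vertices in which each symbol occurs exactly $n/2$ times (its hyperedges are all hyperedges of $3\text{-}QI(n,2)$ contained in this vertex set). The $2$-section $[H]_2$ of a $3$-uniform hypergraph $H$ is the graph on the same vertex set in which two distinct vertices are adjacent iff they lie together in some hyperedge of $H$. The shadow graph $D_2(G)$ of a connected graph $G$ is obtained by taking two copies $G_1$ and $G_2$ of $G$ and joining each vertex $u$ of $G_1$ to the neighbours (in $G_2$) of the corresponding vertex $u'$ of $G_2$. The merged Johnson graph $J(n,m)_I$ has as vertices all $m$-subsets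 of $[n]$, with $M,M'$ adjacent iff $|M\cap M'|\in I$. *)

(* Defs.v *)
From HB Require Import structures.
From mathcomp Require Import all_boot.

Set Implicit Arguments.
Unset Strict Implicit.
Unset Printing Implicit Defensive.

Record sgraph := SGraph {
  gvert :> finType;
  adj : rel gvert;
  adj_sym : symmetric adj;
  adj_irr : irreflexive adj }.

Definition graph_iso (G H : sgraph) : Prop :=
  exists2 f : G -> H, bijective f & forall x y, adj (f x) (f y) = adj x y.

Record hypergraph3 := Hypergraph3 {
  hvert :> finType;
  hedges : {set {set hvert}};
  hedges_card : forall e, e \in hedges -> #|e| = 3 }.

Section InducedSubhypergraph.
Variables (H : hypergraph3) (S : {set H}).

(* A set of elements of the subtype [{x | x \in S}] is an edge when its image
   in [H] is one: these are exactly the edges of [H] contained in [S]. *)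
Definition induced_edges : {set {set {x : H | x \in S}}} :=
  [set e : {set {x : H | x \in S}} | [set val x | x in e] \in hedges H].

Lemma induced_edges_card e : e \in induced_edges -> #|e| = 3.
Proof. by rewrite inE => /hedges_card; rewrite (card_imset _ val_inj). Qed.

Definition induced : hypergraph3 := Hypergraph3 induced_edges_card.

End InducedSubhypergraph.

Section TwoSection.
Variable H : hypergraph3.

Definition section_adj : rel H := fun x y =>
  (x != y) && [exists e in hedges H, (x \in e) && (y \in e)].

Lemma section_adj_sym : symmetric section_adj.
Proof.
move=> x y; rewrite /section_adj eq_sym; congr (_ && _).
by apply: eq_existsb => e; rewrite [(x \in e) && _]andbC.
Qed.

Lemma section_adj_irr : irreflexive section_adj.
Proof. by move=> x; rewrite /section_adj eqxx. Qed.

Definition two_section : sgraph := SGraph section_adj_sym section_adj_irr.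

End TwoSection.

Section Shadow.
Variable G : sgraph.

(* [inl u] and [inr u] are the vertices corresponding to [u] in the first and
   the second copy.  The construction makes sense for every graph, so
   connectedness of [G] is not required. *)
Definition shadow_adj : rel (G + G)%type := fun x y =>
  match x, y with
  | inl u, inl v => adj u v
  | inr u, inr v => adj u v
  | inl u, inr v => adj u v
  | inr v, inl u => adj u v
  end.

Lemma shadow_adj_sym : symmetric shadow_adj.
Proof. by move=> [u|u] [v|v] //=; rewrite adj_sym. Qed.

Lemma shadow_adj_irr : irreflexive shadow_adj.
Proof. by move=> [u|u] /=; rewrite adj_irr. Qed.

Definition shadow : sgraph := SGraph shadow_adj_sym shadow_adj_irr.

End Shadow.

Section MergedJohnson.
Variables (n m : nat) (I : pred nat).

(* The ground set is ['I_n] in place of {1, ..., n}.  Distinctness is required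
   so that the graph has no loops also when [m] satisfies [I]. *)
Definition mjohnson_adj : rel {M : {set 'I_n} | #|M| == m} := fun M M' =>
  (M != M') && I #|val M :&: val M'|.

Lemma mjohnson_adj_sym : symmetric mjohnson_adj.
Proof. by move=> M M'; rewrite /mjohnson_adj eq_sym setIC. Qed.

Lemma mjohnson_adj_irr : irreflexive mjohnson_adj.
Proof. by move=> M; rewrite /mjohnson_adj eqxx. Qed.

Definition mjohnson : sgraph := SGraph mjohnson_adj_sym mjohnson_adj_irr.

End MergedJohnson.

Section QualitativeIndependence.
Variable n : nat.

(* Binary strings are tuples of booleans, [false] being the symbol 0. *)
Definition QI_string (v : n.-tuple bool) : bool :=
  (ohead v == Some false) && [forall b : bool, 4 <= count_mem b v].

Definition QI_vertex : finType := {v : n.-tuple bool | QI_string v}.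

Definition qindep3 (v1 v2 v3 : n.-tuple bool) : bool :=
  [forall g1 : bool, forall g2 : bool, forall g3 : bool, exists j : 'I_n,
    [&& tnth v1 j == g1, tnth v2 j == g2 & tnth v3 j == g3]].

Definition QI_edges : {set {set QI_vertex}} :=
  [set e : {set QI_vertex} |
    [exists v1 : QI_vertex, exists v2 : QI_vertex, exists v3 : QI_vertex,
      (e == [set v1; v2; v3]) && qindep3 (val v1) (val v2) (val v3)]].

Lemma QI_edges_card e : e \in QI_edges -> #|e| = 3.
Proof.
rewrite inE => /existsP[v1 /existsP[v2 /existsP[v3 /andP[/eqP-> q]]]].
have q3 g1 g2 g3 : exists j : 'I_n,
    [&& tnth (val v1) j == g1, tnth (val v2) j == g2 & tnth (val v3) j == g3].
  by apply/existsP; move/forallP/(_ g1)/forallP/(_ g2)/forallP/(_ g3): q.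
have n12 : v1 != v2.
  apply/eqP => E; have [j] := q3 true false true.
  by rewrite E => /and3P[/eqP->].
have n13 : v1 != v3.
  apply/eqP => E; have [j] := q3 true true false.
  by rewrite E => /and3P[/eqP->].
have n23 : v2 != v3.
  apply/eqP => E; have [j] := q3 true true false.
  by rewrite E => /and3P[_ /eqP->].
by rewrite -setUA cardsU1 cards2 !inE (negbTE n12) (negbTE n13) n23.
Qed.

Definition QI : hypergraph3 := Hypergraph3 QI_edges_card.

(* Used for [n] even. *)
Definition UQI : hypergraph3 :=
  @induced QI [set v : QI | [forall b : bool, count_mem b (val v) == n./2]].

End QualitativeIndependence.

(* Main.v *)
Require Import Defs.
From mathcomp Require Import all_boot.
From mathcomp Require Import zify.

(** A balanced string is the indicator of a partition of the positions into two
    halves of size [m = n/2], and we record it by its zero set, the half that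
    contains position 0.  The two copies of a string in the shadow graph
    correspond to the two halves of its partition, and this matches the vertices
    of the shadow graph with all [m]-subsets, because exactly one of a set and
    its complement contains position 0.

    If [A] and [B] are the zero sets of two strings and [k = #|A :&: B|], the
    four cells cut out by the two partitions have sizes [k], [m - k], [m - k]
    and [k].  A third partition that makes a hyperedge with the two must split
    each cell into two non-empty pieces, so [2 <= k <= m - 2]
    ([qindep3_card_cell]).  Conversely, under these bounds such a partition
    arises from [A] by trading one element of each of the two cells inside [A]
    for one element of each of the two cells outside [A] ([splitting_set]).
    Hence adjacency in the 2-section is the condition [2 <= k <= m - 2]
    ([section_adjE]).  Replacing a set by its complement turns [k] into [m - k],
    which leaves the condition unchanged; so it describes the edges between the
    two copies as well as those within one copy. *)

Set Implicit Arguments.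
Unset Strict Implicit.
Unset Printing Implicit Defensive.

(** * Strings and their zero sets *)

Definition zeros n (v : n.-tuple bool) : {set 'I_n} := [set j | ~~ tnth v j].

Definition string_of n (M : {set 'I_n}) : n.-tuple bool :=
  [tuple j \notin M | j < n].

Lemma string_ofK n : cancel (@string_of n) (@zeros n).
Proof. by move=> M; apply/setP=> j; rewrite inE tnth_mktuple negbK. Qed.

Lemma zerosK n : cancel (@zeros n) (@string_of n).
Proof. by move=> v; apply: eq_from_tnth => j; rewrite tnth_mktuple inE negbK. Qed.

Lemma tnth_zeros n (v : n.-tuple bool) j : tnth v j = (j \notin zeros v).
Proof. by rewrite inE negbK. Qed.

Lemma count_mem_tnth n (v : n.-tuple bool) b :
  count_mem b v = #|[set j | tnth v j == b]|.
Proof.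
rewrite -{1}(map_tnth_enum v) count_map cardE enumT -size_filter.
by congr size; apply: eq_filter => j /=; rewrite inE.
Qed.

Lemma count_false n (v : n.-tuple bool) : count_mem false v = #|zeros v|.
Proof.
by rewrite count_mem_tnth; apply: eq_card => j; rewrite !inE eqbF_neg.
Qed.

Lemma count_true n (v : n.-tuple bool) : count_mem true v = #|~: zeros v|.
Proof.
by rewrite count_mem_tnth; apply: eq_card => j; rewrite !inE negbK eqb_id.
Qed.

Lemma ohead_tnth n (v : n.-tuple bool) (i0 : 'I_n) :
  i0 = 0 :> nat -> ohead v = Some (tnth v i0).
Proof.
move=> i00; rewrite (tnth_nth false) i00; case: v => [[|x s] sz] //.
by have := ltn_ord i0; rewrite -{2}(eqP sz).
Qed.

Lemma card_setC_half n (M : {set 'I_n}) :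
  ~~ odd n -> #|M| = n./2 -> #|~: M| = n./2.
Proof. by move=> hev cM; have := cardsC M; rewrite card_ord cM; lia. Qed.

(** * Balanced strings as half-size sets *)

Definition zset n (u : UQI n) : {set 'I_n} := zeros (val (val u)).

Lemma zset_inj n : injective (@zset n).
Proof. by move=> u v /(can_inj (@zerosK n)) /val_inj /val_inj. Qed.

Lemma card_zset n (u : UQI n) : #|zset u| = n./2.
Proof.
by have := valP u; rewrite inE => /forallP/(_ false)/eqP; rewrite count_false.
Qed.

Lemma zset_first n (u : UQI n) (i0 : 'I_n) : i0 = 0 :> nat -> i0 \in zset u.
Proof.
move=> i00; have /andP[/eqP] := valP (val u).
by rewrite (ohead_tnth _ i00) inE => -[->].
Qed.

Lemma zset_surj n (i0 : 'I_n) (M : {set 'I_n}) :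
    8 <= n -> ~~ odd n -> i0 = 0 :> nat -> i0 \in M -> #|M| = n./2 ->
  exists u : UQI n, zset u = M.
Proof.
move=> hn hev i00 iM cM.
have cnt b : count_mem b (string_of M) = n./2.
  by case: b; rewrite ?count_true ?count_false string_ofK ?card_setC_half.
have QIM : QI_string (string_of M).
  rewrite /QI_string (ohead_tnth _ i00) tnth_zeros string_ofK iM /=.
  by apply/forallP=> b; rewrite cnt; lia.
pose w : QI n := Sub (string_of M) QIM.
have wU : w \in [set v : QI n | [forall b : bool, count_mem b (val v) == n./2]].
  by rewrite inE; apply/forallP => b; rewrite cnt.
by exists (Sub w wU); rewrite /zset string_ofK.
Qed.

(** * Qualitatively independent triples *)

Lemma qindep3P n (x y z : n.-tuple bool) :
  reflect (forall a b c, exists j,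
             [/\ tnth x j = a, tnth y j = b & tnth z j = c])
          (qindep3 x y z).
Proof.
apply: (iffP forallP) => [q a b c | q a].
  have /forallP/(_ b)/forallP/(_ c)/existsP[j] := q a.
  by case/and3P=> /eqP ? /eqP ? /eqP ?; exists j.
apply/forallP=> b; apply/forallP=> c; have [j [<- <- <-]] := q a b c.
by apply/existsP; exists j; rewrite !eqxx.
Qed.

Lemma qindep3_swap n (x y z : n.-tuple bool) : qindep3 x y z -> qindep3 y x z.
Proof.
move/qindep3P=> q; apply/qindep3P=> a b c.
by have [j [? ? ?]] := q b a c; exists j.
Qed.

Lemma qindep3_rot n (x y z : n.-tuple bool) : qindep3 x y z -> qindep3 y z x.
Proof.
move/qindep3P=> q; apply/qindep3P=> a b c.
by have [j [? ? ?]] := q c a b; exists j.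
Qed.

(** A hyperedge is unordered, whereas [qindep3] takes its strings in order; the
    symmetry of [qindep3] lets any two members of a hyperedge come first. *)
Lemma QI_edge_pair n (e : {set QI n}) (x y : QI n) :
    e \in hedges (QI n) -> x \in e -> y \in e -> x != y ->
  exists z : QI n, qindep3 (val x) (val y) (val z).
Proof.
rewrite inE => /existsP[v1 /existsP[v2 /existsP[v3 /andP[/eqP-> q]]]].
have q12 := qindep3_swap q; have q1 := qindep3_rot q; have q2 := qindep3_rot q1.
have q11 := qindep3_swap q1; have q22 := qindep3_swap q2.
rewrite !inE -!orbA => /or3P[] /eqP-> /or3P[] /eqP->; rewrite ?eqxx // => _.
- by exists v3.
- by exists v2.
- by exists v3.
- by exists v1.
- by exists v2.
- by exists v1.
Qed.

(** The third string takes both values on every cell of the first two. *)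
Lemma qindep3_card_cell n (x y z : n.-tuple bool) a b :
  qindep3 x y z -> 1 < #|[set j | (tnth x j == a) && (tnth y j == b)]|.
Proof.
move/qindep3P=> q; have [j [xj yj zj]] := q a b true.
have [k [xk yk zk]] := q a b false.
apply/card_gt1P; exists j, k; split; rewrite ?inE ?xj ?yj ?xk ?yk ?eqxx //.
by apply/eqP=> jk; rewrite jk zk in zj.
Qed.

(** A set and its complement can be made to meet the four cells of [A] and [B]
    without changing the size of [A]: remove one element from each cell inside
    [A] and add one from each cell outside.  As every cell has a second element,
    both sides then meet it, and [i0] need not be the one removed. *)
Lemma splitting_set (T : finType) (A B : {set T}) (i0 : T) :
    i0 \in A -> i0 \in B ->
    1 < #|A :&: B| -> 1 < #|A :\: B| -> 1 < #|B :\: A| -> 1 < #|~: (A :|: B)| ->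
  exists Z : {set T}, [/\ #|Z| = #|A|, i0 \in Z &
    forall a b c, exists j, [/\ (j \in A) = a, (j \in B) = b & (j \in Z) = c]].
Proof.
move=> iA iB c11 c10 c01 c00.
have [p] : exists p, p \in (A :&: B) :\ i0.
  by apply/card_gt0P; move: c11; rewrite (cardsD1 i0) inE iA iB.
rewrite !inE => /and3P[pi pA pB].
case/card_gt1P: c10 => [r [r' [+ +]]].
rewrite !inE => /andP[/negPf rB rA] /andP[/negPf rB' rA'] rr'.
case/card_gt1P: c01 => [s [s' [+ +]]].
rewrite !inE => /andP[/negPf sA sB] /andP[/negPf sA' sB'] ss'.
case/card_gt1P: c00 => [q [q' [+ +]]].
rewrite !inE !negb_or => /andP[/negPf qA /negPf qB] /andP[/negPf qA' /negPf qB'] qq'.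
have ne (P : {set T}) x y : x \in P -> (y \in P) = false -> (x == y) = false.
  by move=> xP yP; apply/eqP=> xy; rewrite -xy xP in yP.
pose Z := s |: (q |: A :\ p :\ r).
have ZE j : (j \in Z) = [|| j == s, j == q | [&& j != r, j != p & j \in A]].
  by rewrite !inE.
have pr := ne _ _ _ pB rB; have sq := ne _ _ _ sB qB.
have iZ : i0 \in Z.
  by rewrite ZE iA (ne _ _ _ iB rB) (eq_sym i0 p) pi !orbT.
exists Z; split=> //.
  have : #|A| = (#|A :\ p :\ r|).+2.
    by rewrite (cardsD1 p A) pA (cardsD1 r (A :\ p)) !inE rA eq_sym pr.
  by rewrite /Z !cardsU1 !inE sq sA qA !andbF => ->.
do 3 case.
- by exists i0.
- by exists p; rewrite ZE pA pB eqxx (ne _ _ _ pA sA) (ne _ _ _ pA qA) !andbF.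
- exists r'; rewrite ZE rA' rB' (eq_sym r' r) rr' (eq_sym r' p).
  by rewrite (ne _ _ _ pB rB') !orbT.
- by exists r; rewrite ZE rA rB eqxx (ne _ _ _ rA sA) (ne _ _ _ rA qA).
- by exists s; rewrite ZE sA sB eqxx.
- exists s'; rewrite ZE sA' sB' (eq_sym s' s) (negPf ss').
  by rewrite (ne _ _ _ sB' qB) !andbF.
- by exists q; rewrite ZE qA qB eqxx orbT.
- exists q'; rewrite ZE qA' qB' (eq_sym q' q) (negPf qq') (eq_sym q' s).
  by rewrite (ne _ _ _ sB qB') !andbF.
Qed.

(** * Adjacency and the isomorphism *)

Lemma section_adjE n (u v : UQI n) : 8 <= n -> ~~ odd n ->
  @section_adj (UQI n) u v = (2 <= #|zset u :&: zset v| <= n./2 - 2).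
Proof.
move=> hn hev; have cu := card_zset u; have cv := card_zset v.
have cI := cardsID (zset v) (zset u).
apply/andP/andP => [[uv /existsP[e /and3P[]]] | [k2 km]].
  rewrite inE => eE ue ve.
  have [z q] : exists z : QI n, qindep3 (val (val u)) (val (val v)) (val z).
    by apply: QI_edge_pair eE _ _ _; rewrite ?(inj_eq val_inj) ?imset_f.
  have c11 : 1 < #|zset u :&: zset v|.
    apply: leq_trans (qindep3_card_cell false false q) (subset_leq_card _).
    by apply/subsetP=> j; rewrite !inE !eqbF_neg.
  have c10 : 1 < #|zset u :\: zset v|.
    apply: leq_trans (qindep3_card_cell false true q) (subset_leq_card _).
    by apply/subsetP=> j; rewrite !inE eqbF_neg eqb_id negbK andbC.
  by split; lia.
have n_gt0 : 0 < n by lia.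
pose i0 := Ordinal n_gt0.
have cI' := cardsID (zset u) (zset v); rewrite setIC in cI'.
have cU := cardsUI (zset u) (zset v).
have := cardsC (zset u :|: zset v); rewrite card_ord => cC.
have [||||||Z [cZ iZ qZ]] := @splitting_set _ (zset u) (zset v) i0.
- exact: zset_first.
- exact: zset_first.
- by [].
- lia.
- lia.
- lia.
have [//||w zw] := @zset_surj n i0 Z hn hev _ iZ; first by rewrite cZ.
have q : qindep3 (val (val u)) (val (val v)) (val (val w)).
  apply/qindep3P=> a b c; have [j [ja jb jc]] := qZ (~~ a) (~~ b) (~~ c).
  exists j; rewrite !tnth_zeros -/(zset u) -/(zset v) -/(zset w) zw.
  by rewrite ja jb jc !negbK.
split.
  by apply/eqP=> uv; move: km; rewrite uv setIid cv; lia.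
apply/existsP; exists [set u; v; w]; rewrite !inE !eqxx orbT !andbT.
apply/existsP; exists (val u); apply/existsP; exists (val v).
apply/existsP; exists (val w); rewrite q andbT.
by rewrite !imsetU !imset_set1.
Qed.

Definition half n (x : UQI n + UQI n) : {set 'I_n} :=
  match x with inl u => zset u | inr u => ~: zset u end.

Lemma card_half n (x : UQI n + UQI n) : ~~ odd n -> #|half x| == n./2.
Proof. by move=> hev; case: x => u; rewrite /= ?card_setC_half ?card_zset. Qed.

Definition half_set n (hev : ~~ odd n) (x : UQI n + UQI n) :
    {M : {set 'I_n} | #|M| == n./2} := Sub (half x) (card_half x hev).

Lemma half_set_bij n (hev : ~~ odd n) : 8 <= n -> bijective (half_set hev).
Proof.
move=> hn; have n_gt0 : 0 < n by lia.
pose i0 := Ordinal n_gt0.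
have z0 u : i0 \in zset u by apply: zset_first.
have inj : injective (half_set hev).
  move=> [u|u] [v|v] /(congr1 val) /= E.
  - by rewrite (zset_inj E).
  - by have := z0 u; rewrite E inE z0.
  - by have := z0 v; rewrite -E inE z0.
  - by rewrite (zset_inj (setC_inj E)).
apply: inj_card_bij => //; rewrite -(card_codom inj).
apply/subset_leq_card/subsetP => M _; have /eqP cM := valP M.
have [iM | iM] := boolP (i0 \in val M).
  have [//|u zu] := @zset_surj n i0 (val M) hn hev _ iM cM.
  by apply/codomP; exists (inl u); apply/val_inj.
have [//||u zu] := @zset_surj n i0 (~: val M) hn hev _ _ (card_setC_half hev cM).
  by rewrite inE.
by apply/codomP; exists (inr u); apply/val_inj; rewrite /= zu setCK.
Qed.

Theorem lemma6 (n : nat) (hn : 8 <= n) (hev : ~~ odd n) :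
  graph_iso (shadow (two_section (UQI n)))
            (mjohnson n n./2 [pred k : nat | 2 <= k <= n./2 - 2]).
Proof.
exists (half_set hev); first exact: half_set_bij.
move=> x y.
have -> : @adj (mjohnson n n./2 [pred k : nat | 2 <= k <= n./2 - 2])
              (half_set hev x) (half_set hev y)
          = (2 <= #|val (half_set hev x) :&: val (half_set hev y)| <= n./2 - 2).
  rewrite /= /mjohnson_adj /=; case: eqP => //= E.
  (* equal sets meet in n/2 elements, beyond the upper bound *)
  have /eqP := valP (half_set hev y).
  by move: E => /(congr1 val) /= ->; rewrite setIid => ->; lia.
have cards (u v : UQI n) : [/\ #|zset u :\: zset v| = n./2 - #|zset u :&: zset v|,
    #|~: (zset u :|: zset v)| = #|zset u :&: zset v| &
    #|zset u :&: zset v| <= n./2].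
  have := cardsID (zset v) (zset u); have := cardsUI (zset u) (zset v).
  have := cardsC (zset u :|: zset v); rewrite card_ord !card_zset.
  by split; lia.
case: x y => [u|u] [v|v] /=; rewrite section_adjE //.
- by have [c _ le] := cards u v; rewrite -setDE c; lia.
- by have [c _ le] := cards v u; rewrite setIC -setDE c; lia.
- by have [_ c _] := cards u v; rewrite -setCU c.
Qed.
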